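(* For integers $n,r\ge 0$, $$d_{n,\lambda}^{(r,Y)}=n!\sum_{k=r}^{n}\binom{k}{r}(-1)^{n-k}\frac{E[\langle Y\rangle_{n-k,\lambda}]}{(n-k)!}\quad\text{if } n \ge r,\qquad d_{n,\lambda}^{(r,Y)}=0\quad\text{if } 0\le n\le r-1.$$
   Context: Let $\lambda$ be a nonzero real number. Set $(x)_{0,\lambda}=1$, $(x)_{k,\lambda}=x(x-\lambda)\cdots(x-(k-1)\lambda)$ and $\langle x\rangle_{0,\lambda}=1$, $\langle x\rangle_{k,\lambda}=x(x+\lambda)\cdots(x+(k-1)\lambda)$ for $k\ge 1$. The degenerate exponential is $e_{\lambda}^{x}(t)=\sum_{k\ge 0}(x)_{k,\lambda}\frac{t^{k}}{k!}$ (so $e_\lambda^x(t)=(1+\lambda t)^{x/\lambda}$ for $t$ near $0$). $Y$ is a real random variable whose moment generating function $E[e^{tY}]=\sum_{n\ge 0}E[Y^n]\frac{t^n}{n!}$ exists for all $t$ in some neighborhood of $0$. $E$ denotes expectation. For an integer $r\ge 0$, the probabilistic degenerate $r$-derangement numbers associated with $Y$, $d_{n,\lambda}^{(r,Y)}$, are defined by $$\frac{t^{r}}{(1-t)^{r+1}}E\big[e_{\lambda}^{-Y}(t)\big]=\sum_{n=0}^{\infty}d_{n,\lambda}^{(r,Y)}\frac{t^{n}}{n!}$$ (power series in $t$ near $0$). *)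

(* Defs.v *)
From HB Require Import structures.
From mathcomp Require Import all_boot all_order all_algebra.
From mathcomp Require Import all_classical all_reals all_analysis.
Set Implicit Arguments.
Unset Strict Implicit.
Unset Printing Implicit Defensive.
Import Order.TTheory GRing.Theory Num.Theory.
Import numFieldNormedType.Exports.
Local Open Scope classical_set_scope.
Local Open Scope ring_scope.

Definition deg_falling (R : realType) (lam x : R) (k : nat) : R :=
  \prod_(i < k) (x - i%:R * lam).

Definition deg_rising (R : realType) (lam x : R) (k : nat) : R :=
  \prod_(i < k) (x + i%:R * lam).

(* Meaningful where the series converges, in particular for |lam * t| < 1. *)
Definition deg_exp (R : realType) (lam x t : R) : R :=
  limn (series (fun k => deg_falling lam x k * (t ^+ k / k`!%:R))).

Section Derangement.
Context (disp : measure_display) (T : measurableType disp) (R : realType).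
Variables (P : probability T R) (Y : {RV P >-> R}).

Definition mgf_exists_near0 : Prop := \forall t \near (0 : R), ('M_P Y t < +oo)%E.

(* The convergence is stated in the extended reals because expectations live
   there; it has no hidden default value if the expectation is infinite. *)
Definition r_derangement_egf (lam : R) (r : nat) (a : nat -> R) : Prop :=
  \forall t \near (0 : R),
    (fun N => (series (fun n => a n * (t ^+ n / n`!%:R)) N)%:E) @ \oo -->
      ((t ^+ r / (1 - t) ^+ r.+1)%:E *
        'E_P[fun w => deg_exp lam (- Y w) t])%E.

(* The coefficient sequence of the generating function; such a sequence is
   unique when it exists, and the default 0 is taken if there is none. *)
Definition prob_deg_r_derangement (lam : R) (r : nat) : nat -> R :=
  xget (fun=> 0) [set a : nat -> R | r_derangement_egf lam r a].

End Derangement.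

(* Main.v *)
Require Import Defs.
From HB Require Import structures.
From mathcomp Require Import all_boot all_order all_algebra.
From mathcomp Require Import all_classical all_reals all_analysis.
From mathcomp Require Import measurable_realfun ring lra.
Set Implicit Arguments.
Unset Strict Implicit.
Unset Printing Implicit Defensive.
Import Order.TTheory GRing.Theory Num.Theory.
Import numFieldNormedType.Exports.
Local Open Scope classical_set_scope.
Local Open Scope ring_scope.

(** By definition the numbers d_n are the coefficients, in t^n / n!, of
    t^r / (1-t)^(r+1) * E[e_lam^(-Y)(t)], so the theorem amounts to expanding
    both factors in powers of t and multiplying.

    The second factor is expanded by exchanging expectation and series,
    which gives E[e_lam^(-Y)(t)] = sum_k E[(-Y)_(k,lam)] t^k / k!, where
    (-Y)_(k,lam) = (-1)^k <Y>_(k,lam). The exchange is dominated convergence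
    ([expectation_deg_exp]).
    The domination rests on the inequality
      |(x)_(k,lam)| / k! <= (|lam| + 1/eps)^k e^(eps |x|)
    ([deg_falling_le]), valid for every eps > 0: the growth in x can be made as
    slow an exponential as desired, at the price of a smaller radius in t. If
    eps is so small that e^(eps |Y|) is integrable, which the moment generating
    function provides ([integrable_exp_abs]), then as soon as
    (|lam| + 1/eps) |t| <= 1/2 all partial sums are at most 2 e^(eps |Y|).

    The first factor is absorbed without a general product theorem for series.
    Dividing by 1 - t replaces coefficients by their partial sums, multiplying
    by t shifts them; one round of both is the Pascal recurrence in r for
    c_n = sum_k C(k,r) b_(n-k) ([has_power_series_binomial]).

    Finally the coefficients of a power series are determined by its sum near
    0 ([has_power_series_inj]), so the sequence found in this way is the one
    chosen by the definition of the derangement numbers. *)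

(** * Exponential bounds for degenerate falling factorials *)

Lemma expR_ge_term (R : realType) (x : R) (n : nat) :
  0 <= x -> x ^+ n / n`!%:R <= expR x.
Proof.
move=> x0; case: n => [|n]; first by rewrite expr0 fact0 divr1 -expR0 ler_expR.
by apply: le_trans (expR_ge1Dxn n x0); rewrite lerDr ler01.
Qed.

(** Relative to [l + 1/eps], the factor of index [i] is at most 1 once
    [i + 1 >= eps * a], and at most [eps * a / (i + 1)] before that. The product
    of the early factors is thus a term of the exponential series of
    [eps * a]. *)
Lemma prod_shifted_ratio_le (R : realType) (l eps a : R) (k : nat) :
  0 <= l -> 0 < eps -> 0 <= a ->
  \prod_(i < k) (l + a / i.+1%:R) <= (l + eps^-1) ^+ k * expR (eps * a).
Proof.
move=> l0 e0 a0; have ea0 : 0 <= eps * a by rewrite mulr_ge0 // ltW.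
have le0 : 0 <= l + eps^-1 by rewrite addr_ge0 // invr_ge0 ltW.
elim: k => [|k IH].
  by rewrite big_ord0 expr0 mul1r -expR0 ler_expR.
have fac0 i : 0 <= l + a / i.+1%:R by rewrite addr_ge0 // divr_ge0.
(* Either the last factor is harmless, or every factor is an early one. *)
have [eak|kea] := leP (eps * a) k.+1%:R.
  rewrite big_ord_recr /= exprSr mulrAC ler_pM //.
    by apply: prodr_ge0 => i _; exact: fac0.
  by rewrite lerD2l ler_pdivrMr // -ler_pdivrMl ?invr_gt0 // invrK.
apply: le_trans (_ : (l + eps^-1) ^+ k.+1 * ((eps * a) ^+ k.+1 / k.+1`!%:R) <= _).
  have powE (c : R) : c ^+ k.+1 = \prod_(i < k.+1) c by rewrite prodr_const card_ord.
  rewrite !powE fact_prod big_add1 /= big_mkord natr_prod -prodfV -!big_split /=.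
  apply: ler_prod => i _; rewrite fac0 /=.
  have eai : i.+1%:R <= eps * a by rewrite (le_trans _ (ltW kea)) // ler_nat.
  rewrite mulrDl lerD //.
    by rewrite ler_peMr // ler_pdivlMr // mul1r.
  by rewrite -mulrA mulKf // gt_eqF.
by rewrite ler_wpM2l ?exprn_ge0 // expR_ge_term.
Qed.

(** Since [|x - i lam| <= (i + 1) (|lam| + |x| / (i + 1))], the factorial comes
    out and the previous bound applies. The rate [eps] is free, which is what
    lets a moment generating function with a tiny domain suffice. *)
Lemma deg_falling_le (R : realType) (lam x eps : R) (k : nat) : 0 < eps ->
  `|deg_falling lam x k| <=
    k`!%:R * ((`|lam| + eps^-1) ^+ k * expR (eps * `|x|)).
Proof.
move=> e0; rewrite /deg_falling normr_prod.
apply: le_trans (_ : k`!%:R * \prod_(i < k) (`|lam| + `|x| / i.+1%:R) <= _).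
  rewrite fact_prod big_add1 /= big_mkord natr_prod -big_split /=.
  apply: ler_prod => i _; rewrite normr_ge0 /=.
  rewrite mulrDr mulrCA divff ?pnatr_eq0 // mulr1 [leRHS]addrC.
  apply: le_trans (ler_normB _ _) _; rewrite lerD2l normrM normr_nat.
  by rewrite ler_wpM2r // ler_nat.
by rewrite ler_wpM2l // prod_shifted_ratio_le.
Qed.

Lemma deg_exp_term_le (R : realType) (lam x eps t : R) (k : nat) :
  0 < eps -> (`|lam| + eps^-1) * `|t| <= 2^-1 ->
  `|deg_falling lam x k * (t ^+ k / k`!%:R)| <=
    geometric (expR (eps * `|x|)) 2^-1 k.
Proof.
move=> e0 tle; rewrite /= normrM normf_div normrX normr_nat.
have f0 : (0 : R) < k`!%:R by rewrite ltr0n fact_gt0.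
apply: le_trans (ler_wpM2r _ (deg_falling_le lam x k e0)) _.
  by rewrite divr_ge0 // exprn_ge0.
rewrite -[leLHS]/(_ * _ * (_ * _)).
have -> : k`!%:R * ((`|lam| + eps^-1) ^+ k * expR (eps * `|x|)) *
    (`|t| ^+ k / k`!%:R) =
    expR (eps * `|x|) * ((`|lam| + eps^-1) * `|t|) ^+ k.
  by rewrite exprMn; field; rewrite gt_eqF.
rewrite ler_wpM2l ?expR_ge0 // lerXn2r ?nnegrE ?mulr_ge0 ?addr_ge0 //.
  by rewrite invr_ge0 ltW.
Qed.

Lemma geometric_half_sum_le (R : realType) (c : R) (n : nat) : 0 <= c ->
  series (geometric c 2^-1) n <= 2 * c.
Proof.
move=> c0; rewrite geometric_seriesE; last lra.
have h : (0 : R) <= 2^-1 ^+ n by rewrite exprn_ge0.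
have -> : [sequence c * (1 - 2^-1 ^+ n0) / (1 - 2^-1)]_n0 n
  = 2 * c * (1 - 2^-1 ^+ n) :> R by rewrite /mk_sequence; field.
by rewrite ler_piMr ?mulr_ge0 // lerBlDr lerDl.
Qed.

Lemma deg_exp_sum_le (R : realType) (lam x eps t : R) (n : nat) :
  0 < eps -> (`|lam| + eps^-1) * `|t| <= 2^-1 ->
  `|series (fun k => deg_falling lam x k * (t ^+ k / k`!%:R)) n| <=
    2 * expR (eps * `|x|).
Proof.
move=> e0 tle; apply: le_trans (ler_norm_sum _ _ _) _.
apply: le_trans (geometric_half_sum_le n (expR_ge0 _)).
by apply: ler_sum => k _; exact: deg_exp_term_le.
Qed.

Lemma deg_exp_cvg (R : realType) (lam x eps t : R) :
  0 < eps -> (`|lam| + eps^-1) * `|t| <= 2^-1 ->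
  series (fun k => deg_falling lam x k * (t ^+ k / k`!%:R)) @ \oo -->
    deg_exp lam x t.
Proof.
move=> e0 tle; apply: normed_cvg.
apply: (@series_le_cvg _ _ (geometric (expR (eps * `|x|)) 2^-1)) => [k|k|k|].
- exact: normr_ge0.
- by rewrite geometric_ge0 ?expR_ge0.
- exact: deg_exp_term_le.
- by apply: is_cvg_geometric_series; rewrite ger0_norm; lra.
Qed.

(** * Power series near the origin *)

Definition has_power_series (R : realType) (a : nat -> R) (f : R -> R) : Prop :=
  \forall t \near (0 : R), series (fun n => a n * t ^+ n) @ \oo --> f t.

Lemma dnbhs0_ex_pos (R : realType) (Q : R -> Prop) :
  (\forall t \near (0 : R)^', Q t) -> exists2 t : R, 0 < t & Q t.
Proof.
move=> /nbhs_ballP[e /= e0 Qe]; exists (e / 2); first by rewrite divr_gt0.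
have e2 : 0 < e / 2 by rewrite divr_gt0.
apply: Qe => /=; last by rewrite gt_eqF.
by rewrite /ball /= sub0r normrN gtr0_norm // gtr_pMr // invf_lt1 // ltr1n.
Qed.

(** Convergence at a single [t > 0] bounds [a n * t ^+ n]. The limit is required
    only on a punctured neighborhood because the inductive uniqueness argument
    below divides by [t]. *)
Lemma power_series_coef_le (R : realType) (a : nat -> R) (f : R -> R) :
  (\forall t \near (0 : R)^', series (fun n => a n * t ^+ n) @ \oo --> f t) ->
  exists M K : R, [/\ 0 <= M, 1 <= K & forall n, `|a n| <= M * K ^+ n].
Proof.
move=> /dnbhs0_ex_pos[t t0 /cvgP/cvg_series_bounded/pinfty_ex_gt0[M M0 Mb]].
exists M, (1 + t^-1); split; [exact: ltW|by rewrite lerDl invr_ge0 ltW|move=> n].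
apply: le_trans (_ : M * t^-1 ^+ n <= _); last first.
  by rewrite ler_wpM2l ?(ltW M0) // lerXn2r ?nnegrE ?addr_ge0 ?invr_ge0 ?(ltW t0) ?lerDr.
rewrite exprVn ler_pdivlMr ?exprn_gt0 // -[t ^+ n]gtr0_norm ?exprn_gt0 //.
by rewrite -normrM; exact: (Mb n I).
Qed.

Lemma has_power_series_shift (R : realType) (a : nat -> R) (f : R -> R) :
  has_power_series a f ->
  has_power_series (fun n => if n is m.+1 then a m else 0) (fun t => t * f t).
Proof.
apply: filterS => t fa; rewrite -cvg_shiftS.
rewrite (_ : [sequence _]_n =
    fun n => t * series (fun n => a n * t ^+ n) n) /=; last first.
  apply/funext => n; rewrite /series /= big_nat_recl // mul0r add0r mulr_sumr.
  by apply: eq_bigr => i _; rewrite exprS mulrCA.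
exact: cvgMr.
Qed.

(** Summation by parts: the finite form of [1 / (1 - t)] turning coefficients
    into partial sums, with its explicit remainder. *)
Lemma partial_sums_series (R : realType) (a : nat -> R) (t : R) (N : nat) :
  (1 - t) * series (fun n => series a n.+1 * t ^+ n) N =
  series (fun n => a n * t ^+ n) N - series a N * t ^+ N.
Proof.
elim: N => [|N IH]; first by rewrite /series /= !big_geq // mulr0 mul0r subr0.
rewrite /series /= in IH *.
rewrite [in LHS]big_nat_recr //= mulrDr IH !(@big_nat_recr _ _ _ N) //=.
by rewrite exprS; ring.
Qed.

Lemma series_le_pow (R : realType) (a : nat -> R) (M K : R) (n : nat) :
  0 <= M -> 1 <= K -> (forall i, `|a i| <= M * K ^+ i) ->
  `|series a n| <= M * (2 * K) ^+ n.
Proof.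
move=> M0 K1 aM; have K0 : 0 <= K by lra.
elim: n => [|n IH]; first by rewrite /series /= big_geq // normr0 mulr1.
rewrite /series /= big_nat_recr //=; apply: le_trans (ler_normD _ _) _.
apply: le_trans (lerD IH (aM n)) _; rewrite -mulrDr ler_wpM2l //.
have h : K ^+ n <= (2 * K) ^+ n by rewrite lerXn2r ?nnegrE ?mulr_ge0 //; lra.
have h0 : 0 <= (2 * K) ^+ n by rewrite exprn_ge0 // mulr_ge0.
rewrite [leRHS]exprS; nra.
Qed.

(** The remainder [series a N * t ^+ N] tends to 0 because the partial sums of a
    geometrically bounded sequence are geometrically bounded. *)
Lemma has_power_series_partial_sums (R : realType) (a : nat -> R) (f : R -> R) :
  has_power_series a f ->
  has_power_series (fun n => series a n.+1) (fun t => f t / (1 - t)).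
Proof.
move=> fa; have [M [K [M0 K1 aM]]] := power_series_coef_le (nbhs_dnbhs fa).
have K0 : 0 < K by lra.
have d0 : 0 < (2 * K)^-1 by rewrite invr_gt0; lra.
near=> t.
have tK : `|2 * K * t| < 1.
  rewrite normrM gtr0_norm ?mulr_gt0 // -ltr_pdivlMl ?mulr_gt0 // mulr1.
  near: t; exact: cvgr0_norm_lt.
have t1 : `|t| < 1 by near: t; exact: cvgr0_norm_lt.
have t1N : 1 - t != 0 by move: t1; rewrite ltr_norml => /andP[_ ?]; apply/eqP; lra.
rewrite (_ : series _ = fun N => (series (fun n => a n * t ^+ n) N
    - series a N * t ^+ N) / (1 - t)); last first.
  by apply/funext => N; rewrite -partial_sums_series mulrAC mulfV // mul1r.
apply: cvgMl; rewrite -[f t]subr0; apply: cvgB; first by near: t.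
apply: norm_cvg0; apply: (@squeeze_cvgr _ _ _ _ (cst 0) (geometric M `|2 * K * t|)).
- apply: nearW => n; rewrite normr_ge0 /= normrM normrX.
  apply: le_trans (ler_wpM2r _ (series_le_pow n M0 K1 aM)) _.
    by rewrite exprn_ge0.
  by rewrite /= normrM (@gtr0_norm _ (2 * K)) ?mulr_gt0 // -mulrA -exprMn.
- exact: cvg_cst.
- by apply: cvg_geometric; rewrite normr_id.
Unshelve. all: by end_near.
Qed.

(** The coefficients of the product of [t^r / (1 - t)^(r+1)] with the power
    series of coefficients [b]; the terms with [k < r] vanish. *)
Definition binomial_transform (R : realType) (r : nat) (b : nat -> R) (n : nat) : R :=
  \sum_(k < n.+1) 'C(k, r)%:R * b (n - k)%N.

Lemma binomial_transform0 (R : realType) (b : nat -> R) (n : nat) :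
  binomial_transform 0 b n = series b n.+1.
Proof.
rewrite /binomial_transform /series /= big_mkord (reindex_inj rev_ord_inj) /=.
by apply: eq_bigr => i _; rewrite bin0 mul1r subSS subKn // -ltnS.
Qed.

(** Pascal's rule: one more factor [t / (1 - t)] is a shift followed by partial
    sums. *)
Lemma binomial_transformS (R : realType) (r : nat) (b : nat -> R) (n : nat) :
  binomial_transform r.+1 b n =
  series (fun m => if m is i.+1 then binomial_transform r b i else 0) n.+1.
Proof.
rewrite /series /=; elim: n => [|n IH].
  by rewrite big_nat1 /binomial_transform big_ord_recl big_ord0 bin0n mul0r addr0.
rewrite big_nat_recr //= -IH /binomial_transform.
rewrite big_ord_recl bin0n mul0r add0r -big_split /=.
by apply: eq_bigr => i _; rewrite binS natrD mulrDl.
Qed.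

Lemma has_power_series_binomial (R : realType) (r : nat) (b : nat -> R) (f : R -> R) :
  has_power_series b f ->
  has_power_series (binomial_transform r b)
    (fun t => t ^+ r / (1 - t) ^+ r.+1 * f t).
Proof.
move=> fb; elim: r => [|r IH].
  rewrite (_ : (fun t => _) = fun t => f t / (1 - t)).
    rewrite (_ : binomial_transform 0 b = fun n => series b n.+1).
      exact: has_power_series_partial_sums.
    by apply/funext => n; exact: binomial_transform0.
  by apply/funext => t; rewrite expr0 expr1 mul1r mulrC.
rewrite (_ : binomial_transform r.+1 b = fun n => series (fun m =>
    if m is i.+1 then binomial_transform r b i else 0) n.+1); last first.
  by apply/funext => n; exact: binomial_transformS.
have := has_power_series_partial_sums (has_power_series_shift IH).
congr has_power_series; apply/funext => t.
by rewrite (exprS t) (exprSr (1 - t) r.+1) invfM; ring.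
Qed.

(** The series minus its constant term is [O(t)], with a constant uniform over
    the partial sums. *)
Lemma power_series0_coef0 (R : realType) (a : nat -> R) :
  (\forall t \near (0 : R)^', series (fun n => a n * t ^+ n) @ \oo --> (0 : R)) ->
  a 0%N = 0.
Proof.
move=> a0; have [M [K [M0 K1 aM]]] := @power_series_coef_le R a (cst 0) a0.
have K0 : 0 < K by lra.
apply/eqP; rewrite -normr_eq0 eq_le normr_ge0 andbT.
apply/ler_addgt0Pl => e e0; rewrite addr0.
have [t [t0 tK tM ta]] : exists t : R, [/\ 0 < t, K * t <= 2^-1,
    2 * M * K * t <= e &
    series (fun n => a n * t ^+ n) @ \oo --> (0 : R)].
  have : \forall t \near (0 : R)^', [/\ K * `|t| <= 2^-1, 2 * M * K * `|t| <= e &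
      series (fun n => a n * t ^+ n) @ \oo --> (0 : R)].
    have c0 : 0 < 2 * M * K + 1.
      by rewrite ltr_wpDl // mulr_ge0 ?mulr_ge0 // ltW.
    near=> t; split.
    - rewrite -ler_pdivlMl //; near: t; 
      by apply: dnbhs0_le; rewrite mulr_gt0 ?invr_gt0.
    - apply: le_trans (_ : (2 * M * K + 1) * `|t| <= _).
        by rewrite ler_wpM2r // lerDl.
      rewrite -ler_pdivlMl //; near: t; 
      by apply: dnbhs0_le; rewrite mulr_gt0 ?invr_gt0.
    - by near: t.
  move=> /dnbhs0_ex_pos[t t0 [tK tM ta]]; exists t; split=> //.
  - by move: tK; rewrite gtr0_norm.
  - by move: tM; rewrite gtr0_norm.
(* Past the constant term, the geometric bound has ratio K t <= 1/2. *)
have tail N : `|series (fun n => a n * t ^+ n) N.+1 - a 0%N| <= e.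
  rewrite /series /= big_nat_recl // expr0 mulr1 addrC addKr.
  apply: le_trans (ler_norm_sum _ _ _) _.
  apply: le_trans tM; have -> : 2 * M * K * t = 2 * (M * (K * t)) by ring.
  apply: le_trans (geometric_half_sum_le N _); last first.
    by rewrite !mulr_ge0 // ltW.
  apply: ler_sum => i _ /=; rewrite normrM normrX (gtr0_norm t0).
  apply: le_trans (ler_wpM2r _ (aM i.+1)) _; first by rewrite exprn_ge0 // ltW.
  rewrite -mulrA -exprMn exprS (mulrA M (K * t)) ler_wpM2l ?mulr_ge0 ?(ltW K0) ?(ltW t0) //.
  by rewrite lerXn2r ?nnegrE ?mulr_ge0 ?(ltW K0) ?(ltW t0).
have : (fun N => `|series (fun n => a n * t ^+ n) N.+1 - a 0%N|) @ \oo -->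
    `|a 0%N|.
  rewrite -[X in _ --> X]normrN -[in X in _ --> X](sub0r (a 0%N)).
  apply: cvg_norm; apply: cvgB; last exact: cvg_cst.
  by rewrite (cvg_shiftS (series (fun n => a n * t ^+ n))).
move=> h; rewrite -(cvg_lim _ h) //; apply: limr_le; first exact: cvgP h.
by apply: nearW.
Unshelve. all: by end_near.
Qed.

Lemma power_series0_coef (R : realType) (n : nat) (a : nat -> R) :
  (\forall t \near (0 : R)^', series (fun n => a n * t ^+ n) @ \oo --> (0 : R)) ->
  a n = 0.
Proof.
elim: n a => [|n IH] a a0; first exact: power_series0_coef0.
have z := power_series0_coef0 a0.
apply: (IH (fun m => a m.+1)).
near=> t.
have t0 : t != 0 by near: t; exact: nbhs_dnbhs_neq.
have : series (fun n => a n * t ^+ n) @ \oo --> (0 : R) by near: t.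
rewrite -cvg_shiftS => h.
rewrite (_ : series _ = fun n => t^-1 * [sequence
    series (fun n => a n * t ^+ n) n.+1]_n n); last first.
  apply/funext => N; rewrite /series /= big_nat_recl // z mul0r add0r mulr_sumr.
  by apply: eq_bigr => i _; rewrite exprS mulrCA mulKf.
by rewrite -(mulr0 t^-1); exact: cvgMr.
Unshelve. all: by end_near.
Qed.

Lemma has_power_series_inj (R : realType) (a b : nat -> R) (f : R -> R) :
  has_power_series a f -> has_power_series b f -> a = b.
Proof.
move=> fa fb; apply/funext => n; apply/eqP; rewrite -subr_eq0; apply/eqP.
apply: (@power_series0_coef R n (fun n => a n - b n)); apply: nbhs_dnbhs.
apply: filterS2 fa fb => t fa fb; rewrite -(subrr (f t)).
rewrite (_ : series _ = series (fun n => a n * t ^+ n) \- series (fun n => b n * t ^+ n)).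
  exact: cvgB.
apply/funext => N; rewrite /series /= -sumrB.
by apply: eq_bigr => i _; rewrite mulrBl.
Qed.

(** * Exchanging expectation and the degenerate exponential series *)

Section Moments.
Context (disp : measure_display) (T : measurableType disp) (R : realType).
Variables (P : probability T R) (Y : {RV P >-> R}).

(** The moment generating function is finite at some [eps] and at [- eps], and
    [e^(eps |y|) <= e^(eps y) + e^(- eps y)]. *)
Lemma integrable_exp_abs : mgf_exists_near0 Y ->
  exists2 eps : R, 0 < eps &
    P.-integrable setT (fun w => (expR (eps * `|Y w|))%:E).
Proof.
move=> mgfY.
have [eps e0 [mp mn]] : exists2 eps : R, 0 < eps &
    ('M_P Y eps < +oo)%E /\ ('M_P Y (- eps) < +oo)%E.
  apply: dnbhs0_ex_pos; apply: nbhs_dnbhs.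
  have mgfN : \forall t \near (0 : R), ('M_P Y (- t) < +oo)%E.
    by move: mgfY; rewrite /mgf_exists_near0 -{1}oppr0 => /nearN.
  by apply: filterS2 mgfY mgfN.
exists eps => //.
have int c : ('M_P Y c < +oo)%E ->
    P.-integrable setT (fun w => (expR (c * Y w))%:E).
  rewrite /mmt_gen_fun unlock => fin; apply/integrableP; split.
    by apply/measurable_EFinP; apply: measurableT_comp => //; exact: measurable_funM.
  apply: le_lt_trans fin; rewrite le_eqVlt; apply/orP; left; apply/eqP.
  by apply: eq_integral => w _ /=; rewrite ger0_norm ?expR_ge0 // mulrC.
apply: le_integrable (integrableD measurableT (int _ mp) (int _ mn)) => //.
  apply/measurable_EFinP; apply: measurableT_comp => //.
  by apply: measurable_funM => //; apply: measurableT_comp.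
move=> w _; rewrite /= lee_fin [leLHS]ger0_norm ?expR_ge0 //.
rewrite [leRHS]ger0_norm ?addr_ge0 ?expR_ge0 //.
have [y0|y0] := leP 0 (Y w); first by rewrite ger0_norm // lerDl expR_ge0.
by rewrite ltr0_norm // mulrN -mulNr lerDr expR_ge0.
Qed.

Lemma measurable_deg_falling (lam : R) (k : nat) :
  measurable_fun setT (fun w => deg_falling lam (- Y w) k).
Proof.
apply: measurable_prod => i _; apply: measurable_funB => //.
exact: measurableT_comp.
Qed.

Lemma integrable_deg_falling (lam : R) (k : nat) : mgf_exists_near0 Y ->
  P.-integrable setT (fun w => (deg_falling lam (- Y w) k)%:E).
Proof.
move=> /integrable_exp_abs[eps e0 int].
have := integrableZl measurableT (k`!%:R * (`|lam| + eps^-1) ^+ k) int.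
apply: le_integrable => //.
  by apply/measurable_EFinP; exact: measurable_deg_falling.
move=> w _; rewrite /= lee_fin.
apply: le_trans (deg_falling_le lam (- Y w) k e0) _.
by rewrite normrN mulrA ler_norm.
Qed.

Lemma expectation_deg_rising (lam : R) (k : nat) : mgf_exists_near0 Y ->
  ('E_P[fun w => deg_rising lam (Y w) k] =
    ((-1) ^+ k * fine 'E_P[fun w => deg_falling lam (- Y w) k])%:E)%E.
Proof.
move=> mgfY; rewrite unlock EFinM fineK; last first.
  by apply: integrable_fin_num => //; exact: integrable_deg_falling.
rewrite -integralZl //; last exact: integrable_deg_falling.
apply: eq_integral => w _; rewrite -EFinM; congr EFin.
rewrite /deg_falling /deg_rising.
rewrite -[k in (-1) ^+ k]card_ord -prodr_const -big_split /=.
by apply: eq_bigr => i _; ring.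
Qed.

(** Dominated convergence, the partial sums being dominated by
    [2 e^(eps |Y|)]. *)
Lemma expectation_deg_exp (lam : R) : mgf_exists_near0 Y ->
  \forall t \near (0 : R),
    ('E_P[fun w => deg_exp lam (- Y w) t] \is a fin_num)%E /\
    series (fun k => fine 'E_P[fun w => deg_falling lam (- Y w) k]%E / k`!%:R
       * t ^+ k) @ \oo --> fine 'E_P[fun w => deg_exp lam (- Y w) t]%E.
Proof.
move=> mgfY; have [eps e0 int] := integrable_exp_abs mgfY.
have c0 : 0 < `|lam| + eps^-1 by rewrite ltr_wpDl // invr_gt0.
near=> t.
have tle : (`|lam| + eps^-1) * `|t| <= 2^-1.
  rewrite -ler_pdivlMl //; near: t; apply: cvgr0_norm_le => //.
  by rewrite mulr_gt0 ?invr_gt0.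
pose S n w := series (fun k => deg_falling lam (- Y w) k * (t ^+ k / k`!%:R)) n.
have mS n : measurable_fun setT (S n).
  rewrite /S /series /=; apply: measurable_sum => k.
  by apply: measurable_funM => //; exact: measurable_deg_falling.
have Scvg w : (fun n => S n w) @ \oo --> deg_exp lam (- Y w) t.
  exact: deg_exp_cvg e0 tle.
have [intE _ cvgE] : [/\ P.-integrable setT
      (fun w => (deg_exp lam (- Y w) t)%:E),
    True & (fun n => \int[P]_w (S n w)%:E)%E @ \oo -->
      (\int[P]_w (deg_exp lam (- Y w) t)%:E)%E].
  have [//|||||intE _ cvgE] := @dominated_convergence _ _ _ P setT measurableT
    (fun n w => (S n w)%:E) (fun w => (deg_exp lam (- Y w) t)%:E)
    (fun w => 2%:E * (expR (eps * `|Y w|))%:E)%E.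
  - by move=> n; exact/measurable_EFinP.
  - by apply/measurable_EFinP; apply: measurable_fun_cvg mS _ => w _; exact: Scvg.
  - apply: aeW => w _; apply: cvg_EFin; first exact: nearW.
    exact: Scvg.
  - exact: integrableZl.
  - apply: aeW => w n _; rewrite /= lee_fin -(normrN (Y w)).
    exact: deg_exp_sum_le.
  - by split.
have fin : ('E_P[fun w => deg_exp lam (- Y w) t] \is a fin_num)%E.
  by rewrite unlock; exact: integrable_fin_num.
split=> //; set u := series _.
suff uE n : (\int[P]_w (S n w)%:E)%E = (u n)%:E.
  suff : (fun n => (u n)%:E) @ \oo -->
    (fine ('E_P[fun w => deg_exp lam (- Y w) t])%E)%:E by move/fine_cvg.
  have EE : 'E_P[fun w => deg_exp lam (- Y w) t]%E =
    (\int[P]_w (deg_exp lam (- Y w) t)%:E)%E by rewrite unlock.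
  rewrite fineK // EE.
  by rewrite (_ : (fun n => (u n)%:E) = fun n => (\int[P]_w (S n w)%:E)%E) //;
    apply/funext => n; rewrite uE.
rewrite /u /S /series /=.
under eq_integral do rewrite -sumEFin.
rewrite integral_sum //; last first.
  move=> k; under eq_fun do rewrite mulrC EFinM.
  by apply: integrableZl => //; exact: integrable_deg_falling.
rewrite -sumEFin; apply: eq_bigr => k _.
under eq_integral do rewrite mulrC EFinM.
rewrite integralZl //; last exact: integrable_deg_falling.
rewrite EFinM mulrAC -mulrA [in RHS]mulrC EFinM fineK; last first.
  by rewrite unlock; apply: integrable_fin_num => //; exact: integrable_deg_falling.
by rewrite unlock.
Unshelve. all: by end_near.
Qed.

End Moments.

(** * Identification of the derangement numbers *)

Section Coefficients.
Context (disp : measure_display) (T : measurableType disp) (R : realType).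
Variables (P : probability T R) (Y : {RV P >-> R}).

(** Near 0 the expectation is finite, so the convergence in the extended reals
    that defines the numbers is an ordinary power series expansion. *)
Lemma r_derangement_egfE (lam : R) (r : nat) (a : nat -> R) :
  mgf_exists_near0 Y ->
  r_derangement_egf Y lam r a <->
  has_power_series (fun n => a n / n`!%:R)
    (fun t => t ^+ r / (1 - t) ^+ r.+1 *
      fine ('E_P[fun w => deg_exp lam (- Y w) t])%E).
Proof.
move=> mgfY; rewrite /r_derangement_egf /has_power_series.
have serE t : series (fun n => a n * (t ^+ n / n`!%:R)) =
    series (fun n => a n / n`!%:R * t ^+ n).
  by congr series; apply/funext => n; rewrite mulrAC mulrA.
split=> h; apply: filterS2 h (expectation_deg_exp lam mgfY) => t h [fin _].
- by move: h; rewrite -(fineK fin) -EFinM serE => /fine_cvg.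
- rewrite -(fineK fin) -EFinM serE; apply: cvg_EFin; first exact: nearW.
  exact: h.
Qed.

(** The binomial transform of the moments shows that a generating sequence
    exists; uniqueness makes it the chosen one. *)
Lemma prob_deg_r_derangementE (lam : R) (r n : nat) : mgf_exists_near0 Y ->
  prob_deg_r_derangement Y lam r n = n`!%:R * binomial_transform r
    (fun k => fine ('E_P[fun w => deg_falling lam (- Y w) k])%E / k`!%:R) n.
Proof.
move=> mgfY; set c := binomial_transform r _.
have fact_neq0 m : m`!%:R != 0 :> R by rewrite pnatr_eq0 -lt0n fact_gt0.
have gfc : has_power_series c (fun t => t ^+ r / (1 - t) ^+ r.+1 *
      fine ('E_P[fun w => deg_exp lam (- Y w) t])%E).
  apply: has_power_series_binomial.
  by apply: filterS (expectation_deg_exp lam mgfY) => t [].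
rewrite /prob_deg_r_derangement; case: xgetP => [a _ ega|].
  move/(r_derangement_egfE _ _ _ mgfY) in ega.
  by rewrite (has_power_series_inj gfc ega) mulrC divfK.
move=> /(_ (fun m => m`!%:R * c m)) []; apply/r_derangement_egfE => //.
rewrite (_ : (fun m => _) = c) //.
by apply/funext => m; rewrite mulrAC divff // mul1r.
Qed.

End Coefficients.

Theorem theorem2p7 (disp : measure_display) (T : measurableType disp)
    (R : realType) (P : probability T R) (Y : {RV P >-> R}) (lam : R)
    (lam_neq0 : lam != 0) (mgfY : mgf_exists_near0 Y) (n r : nat) :
  ((r <= n)%N ->
    ((prob_deg_r_derangement Y lam r n)%:E =
      (n`!%:R : R)%:E * \sum_(r <= k < n.+1)
        ('C(k, r)%:R * (-1) ^+ (n - k) : R)%:E *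
        ('E_P[fun w => deg_rising lam (Y w) (n - k)] *
         (((n - k)`!%:R : R)^-1)%:E))%E) /\
  ((n < r)%N -> prob_deg_r_derangement Y lam r n = 0).
Proof.
rewrite (prob_deg_r_derangementE lam r n mgfY) /binomial_transform.
split=> [rn|nr]; last first.
  rewrite big1 ?mulr0 // => k _; rewrite bin_small ?mul0r //.
  exact: leq_ltn_trans (ltnSE (ltn_ord k)) nr.
rewrite EFinM; congr (_ * _)%E.
rewrite -(big_mkord xpredT (fun k => 'C(k, r)%:R * (fine
  ('E_P[fun w => deg_falling lam (- Y w) (n - k)])%E / (n - k)`!%:R))).
rewrite (big_cat_nat (n := r)) //=; last exact: leqW.
rewrite big_nat_cond big1 ?add0r; last first.
  by move=> k /andP[/andP[_ kr] _]; rewrite bin_small ?mul0r.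
rewrite -sumEFin; apply: eq_bigr => k _.
rewrite expectation_deg_rising // -!EFinM; congr EFin.
have sgn : (-1) ^+ (n - k) * (-1) ^+ (n - k) = 1 :> R.
  by rewrite -exprMn mulrNN mul1r expr1n.
by rewrite -!mulrA (mulrA ((-1) ^+ _) ((-1) ^+ _)) sgn mul1r.
Qed.
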